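(* Let $f,g\in\mathbb{R}^N$ be signals on the point cloud and $\alpha\in\mathbb{R}$. The PMFHT of the $\alpha$-order manifold convolution $f\circledast_\alpha g$ satisfies $$\widehat{(f\circledast_\alpha g)}^{(\alpha)}=\hat f^{(\alpha)}\odot\hat g^{(\alpha)},$$ where $\odot$ denotes element-wise (Hadamard) multiplication.
   Context: Discrete Laplace–Beltrami data. Let $P=\{p_1,\dots,p_N\}\subset\mathbb{R}^3$ be a point cloud sampled from a surface and let $t>0$. For each $i$, let $\hat T_{p_i}$ be the estimated tangent plane at $p_i$ (best-fitting plane to the points of $P$ in a ball around $p_i$), and let $b_{ii}>0$ be the area of the Voronoi cell of $p_i$ in the planar Voronoi diagram, on $\hat T_{p_i}$, of the projections of the points of $P$ in a ball $B(p_i,\delta)$. Let $B=\mathrm{diag}(b_{11},\dots,b_{NN})$ (mass matrix) and let $Q$ be the real symmetric matrix with $q_{ij}=\frac{b_{ii}b_{jj}}{4\pi t^2}\exp(-\|p_i-p_j\|^2/(4t))$ for $i\ne j$ and $q_{ii}=-\sum_{j\neq i}q_{ij}$. Let $H\in\mathbb{R}^{N\times N}$ be a matrix whose columns $H_i$ are generalized eigenvectors, $QH_i=-\lambda_i BH_i$, normalized so that $H^\top BH=I$. Fractional transform. Put $F_M:=H^\top B^{1/2}$, a real orthogonal matrix. Fix a spectral decomposition $F_M=V\Omega V^*$ with $V$ unitary and $\Omega=\mathrm{diag}(\omega_1,\dots,\omega_N)$, $|\omega_i|=1$. For $\alpha\in\mathbb{R}$ put $F_M^{(\alpha)}:=V\Omega^\alpha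 V^*$ with $\Omega^\alpha=\mathrm{diag}(\omega_1^\alpha,\dots,\omega_N^\alpha)$, where $\omega_i^\alpha:=e^{\mathrm{i}\alpha\theta_i}$ for a choice of real argument $\theta_i$ of $\omega_i$ fixed once for all $\alpha$. The point cloud manifold fractional harmonic transform (PMFHT) of order $\alpha$ of a (real or complex) signal $f$ is $\hat f^{(\alpha)}:=F_M^{(\alpha)}(B^{1/2}f)\in\mathbb{C}^N$. Translation and convolution. Let $\delta_i\in\mathbb{R}^N$ be the unit impulse at point $i$ (the $i$-th standard basis vector). The $\alpha$-order generalized translation of $g$ toward point $i$ is $T_i^{(\alpha)}g:=B^{-1/2}F_M^{(-\alpha)}\bigl(\hat g^{(\alpha)}\odot\hat\delta_i^{(\alpha)}\bigr)$. The $\alpha$-order manifold convolution is $f\circledast_\alpha g:=\sum_{i=1}^N f(i)\,T_i^{(\alpha)}g$. *)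

(* Defs.v *)
From HB Require Import structures.
From mathcomp Require Import all_boot all_order all_algebra.
From mathcomp Require Import complex.
From mathcomp Require Import all_classical all_reals all_analysis.

Set Implicit Arguments.
Unset Strict Implicit.
Unset Printing Implicit Defensive.

Import Order.TTheory GRing.Theory Num.Theory.
Import numFieldNormedType.Exports.

Local Open Scope classical_set_scope.
Local Open Scope ring_scope.
Local Open Scope complex_scope.
Local Open Scope sesquilinear_scope.

(* The Euclidean norm; the library norm on matrices is the sup norm. *)
Definition enorm (R : realType) (n : nat) (x : 'rV[R]_n) : R :=
  Num.sqrt (\sum_k x 0 k ^+ 2).

(* A plane of R^3 through a point c is given by a 2 x 3 matrix E whose rows are
   an orthonormal basis of its direction: it is the set of the c + z *m E, and
   z : 'rV_2 are isometric coordinates on it. *)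
Definition orthonormal_frame (R : realType) (E : 'M[R]_(2, 3)) : Prop :=
  E *m E^T = 1%:M.

Definition plane_coord (R : realType) (c : 'rV[R]_3) (E : 'M[R]_(2, 3))
    (x : 'rV[R]_3) : 'rV[R]_2 := (x - c) *m E^T.

Definition plane_proj (R : realType) (c : 'rV[R]_3) (E : 'M[R]_(2, 3))
    (x : 'rV[R]_3) : 'rV[R]_3 := c + plane_coord c E x *m E.

Definition fit_error (R : realType) (N : nat) (p : 'I_N -> 'rV[R]_3) (r : R)
    (i : 'I_N) (E : 'M[R]_(2, 3)) : R :=
  \sum_(j | enorm (p j - p i) < r) enorm (p j - plane_proj (p i) E (p j)) ^+ 2.

(* Least-squares best fit, among the planes through p i, to the points of the
   cloud in the ball of radius r around p i. *)
Definition estimated_tangent_plane (R : realType) (N : nat)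
    (p : 'I_N -> 'rV[R]_3) (r : R) (i : 'I_N) (E : 'M[R]_(2, 3)) : Prop :=
  orthonormal_frame E /\
  forall E' : 'M[R]_(2, 3), orthonormal_frame E' ->
    fit_error p r i E <= fit_error p r i E'.

Definition plane_point (R : realType) (z : R * R) : 'rV[R]_2 :=
  \row_(k < 2) (if k == 0 then z.1 else z.2).

Definition voronoi_cell (R : realType) (N : nat) (p : 'I_N -> 'rV[R]_3)
    (E : 'M[R]_(2, 3)) (delta : R) (i : 'I_N) : set (R * R) :=
  [set z | forall j : 'I_N, enorm (p j - p i) < delta ->
     enorm (plane_point z - plane_coord (p i) E (p i)) <=
     enorm (plane_point z - plane_coord (p i) E (p j))].

Definition area (R : realType) (A : set (R * R)) : \bar R :=
  (@lebesgue_measure R \x @lebesgue_measure R)%E A.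

Definition mass_mx (R : realType) (N : nat) (b : 'I_N -> R) : 'M[R]_N :=
  diag_mx (\row_i b i).

Definition stiff_weight (R : realType) (N : nat) (p : 'I_N -> 'rV[R]_3) (t : R)
    (b : 'I_N -> R) (i j : 'I_N) : R :=
  b i * b j / (4 * pi * t ^+ 2) * expR (- (enorm (p i - p j) ^+ 2 / (4 * t))).

Definition stiff_mx (R : realType) (N : nat) (p : 'I_N -> 'rV[R]_3) (t : R)
    (b : 'I_N -> R) : 'M[R]_N :=
  \matrix_(i, j) (if i == j then - \sum_(k | k != i) stiff_weight p t b i k
                  else stiff_weight p t b i j).

Definition mass_sqrt (R : realType) (N : nat) (b : 'I_N -> R) : 'M[R]_N :=
  diag_mx (\row_i Num.sqrt (b i)).

Definition mass_isqrt (R : realType) (N : nat) (b : 'I_N -> R) : 'M[R]_N :=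
  diag_mx (\row_i (Num.sqrt (b i))^-1).

Definition cmx (R : realType) (m n : nat) (A : 'M[R]_(m, n)) : 'M[R[i]]_(m, n) :=
  map_mx (fun x : R => x%:C) A.

Definition harmonic_mx (R : realType) (N : nat) (b : 'I_N -> R) (H : 'M[R]_N) :
  'M[R]_N := H^T *m mass_sqrt b.

(* e^{i phi} *)
Definition cis (R : realType) (phi : R) : R[i] := cos phi +i* sin phi.

Definition spectral_decomposition (R : realType) (N : nat) (F : 'M[R[i]]_N)
    (V : 'M[R[i]]_N) (omega : 'I_N -> R[i]) : Prop :=
  [/\ V \is unitarymx, (forall i, `|omega i| = 1)
    & F = V *m diag_mx (\row_i omega i) *m V^t*].

(* F_M^(alpha), given the unitary factor V of a spectral decomposition of F_M
   and real arguments theta i of its eigenvalues. *)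
Definition frac_mx (R : realType) (N : nat) (V : 'M[R[i]]_N) (theta : 'I_N -> R)
    (alpha : R) : 'M[R[i]]_N :=
  V *m diag_mx (\row_i cis (alpha * theta i)) *m V^t*.

Definition PMFHT (R : realType) (N : nat) (b : 'I_N -> R) (V : 'M[R[i]]_N)
    (theta : 'I_N -> R) (alpha : R) (f : 'cV[R[i]]_N) : 'cV[R[i]]_N :=
  frac_mx V theta alpha *m (cmx (mass_sqrt b) *m f).

Definition hadamard (R : realType) (N : nat) (x y : 'cV[R[i]]_N) : 'cV[R[i]]_N :=
  map2_mx *%R x y.

Definition impulse (R : realType) (N : nat) (i : 'I_N) : 'cV[R]_N :=
  delta_mx i 0.

Definition translation (R : realType) (N : nat) (b : 'I_N -> R)
    (V : 'M[R[i]]_N) (theta : 'I_N -> R) (alpha : R) (i : 'I_N)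
    (g : 'cV[R[i]]_N) : 'cV[R[i]]_N :=
  cmx (mass_isqrt b) *m (frac_mx V theta (- alpha) *m
    hadamard (PMFHT b V theta alpha g)
             (PMFHT b V theta alpha (cmx (impulse R i)))).

Definition convolution (R : realType) (N : nat) (b : 'I_N -> R)
    (V : 'M[R[i]]_N) (theta : 'I_N -> R) (alpha : R) (f g : 'cV[R[i]]_N) :
    'cV[R[i]]_N :=
  \sum_i f i 0 *: translation b V theta alpha i g.

(* Main.v *)
Require Import Defs.
From mathcomp Require Import all_boot all_order all_algebra.
From mathcomp Require Import complex.
From mathcomp Require Import all_classical all_reals all_analysis.

(** The convolution theorem is linear algebra over two invertible factors.

    Write A for the transform of order alpha, that is, the matrix
    V Omega^alpha V^* B^(1/2).  Since V is unitary, the powers of Omega are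
    diagonal with e^(i alpha theta_k) e^(-i alpha theta_k) = 1, and the masses
    are positive, the matrix B^(-1/2) V Omega^(-alpha) V^* is an inverse of A.
    Translation toward point i is defined as this inverse applied to
    the product of the spectra of g and of the impulse at i, so that the
    transform of the translate is exactly this product ([PMFHT_translation]).

    The transform and the Hadamard product by a fixed vector being linear, the
    spectrum of the convolution is the Hadamard product of the spectrum of g
    with sum_i f(i) A delta_i = A (sum_i f(i) delta_i) = A f.  *)

Set Implicit Arguments.
Unset Strict Implicit.
Unset Printing Implicit Defensive.

Import Order.TTheory GRing.Theory Num.Theory.

Local Open Scope ring_scope.
Local Open Scope complex_scope.
Local Open Scope sesquilinear_scope.

Lemma cis_mulN (R : realType) (phi : R) : cis phi * cis (- phi) = 1.
Proof.
rewrite /cis cosN sinN; apply/eqP; rewrite eq_complex /=.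
by rewrite mulrN opprK -!expr2 cos2Dsin2 mulrN [sin _ * _]mulrC addNr !eqxx.
Qed.

Lemma frac_mxN_inverse (R : realType) (N : nat) (V : 'M[R[i]]_N)
    (theta : 'I_N -> R) (alpha : R) :
  V \is unitarymx -> frac_mx V theta alpha *m frac_mx V theta (- alpha) = 1%:M.
Proof.
move=> /unitarymxP VVt.
have VtV : V^t* *m V = 1%:M by apply: mulmx1C.
rewrite /frac_mx !mulmxA -[_ *m V^t* *m V]mulmxA VtV mulmx1.
rewrite -[V *m _ *m diag_mx _]mulmxA mulmx_diag.
set D := diag_mx _; suff -> : D = 1%:M by rewrite mulmx1.
rewrite /D -diag_const_mx; congr diag_mx; apply/rowP => k.
by rewrite !mxE mulNr cis_mulN.
Qed.

Lemma mass_sqrt_isqrt (R : realType) (N : nat) (b : 'I_N -> R) :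
  (forall i, 0 < b i) -> cmx (mass_sqrt b) *m cmx (mass_isqrt b) = 1%:M.
Proof.
move=> b_gt0.
rewrite /cmx -(map_mxM (real_complex R)) mulmx_diag -(map_mx1 (real_complex R)).
congr (map_mx _ _); rewrite -diag_const_mx.
congr diag_mx; apply/rowP => k.
by rewrite !mxE divff // gt_eqF // sqrtr_gt0.
Qed.

(** The spectrum of a translate is a product of spectra because translation
    applies the inverse transform, B^(-1/2) F^(-alpha), to that product. *)
Lemma PMFHT_translation (R : realType) (N : nat) (b : 'I_N -> R)
    (V : 'M[R[i]]_N) (theta : 'I_N -> R) (alpha : R) (i : 'I_N)
    (g : 'cV[R[i]]_N) :
  (forall i, 0 < b i) -> V \is unitarymx ->
  PMFHT b V theta alpha (translation b V theta alpha i g) =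
  hadamard (PMFHT b V theta alpha g)
           (PMFHT b V theta alpha (cmx (impulse R i))).
Proof.
move=> b_gt0 V_unitary; rewrite {1}/PMFHT /translation.
rewrite [X in _ *m X]mulmxA mass_sqrt_isqrt // mul1mx.
by rewrite mulmxA frac_mxN_inverse // mul1mx.
Qed.

Lemma PMFHT_sum (R : realType) (N : nat) (b : 'I_N -> R) (V : 'M[R[i]]_N)
    (theta : 'I_N -> R) (alpha : R) (I : finType) (c : I -> R[i])
    (h : I -> 'cV[R[i]]_N) :
  PMFHT b V theta alpha (\sum_i c i *: h i) =
  \sum_i c i *: PMFHT b V theta alpha (h i).
Proof.
rewrite /PMFHT mulmx_sumr mulmx_sumr; apply: eq_bigr => i _.
by rewrite -!scalemxAr.
Qed.

Lemma hadamard_sumr (R : realType) (N : nat) (I : finType) (c : I -> R[i])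
    (x : 'cV[R[i]]_N) (y : I -> 'cV[R[i]]_N) :
  hadamard x (\sum_i c i *: y i) = \sum_i c i *: hadamard x (y i).
Proof.
apply/colP => k; rewrite !mxE !summxE mulr_sumr; apply: eq_bigr => i _.
by rewrite !mxE mulrCA.
Qed.

Lemma hadamardC (R : realType) (N : nat) (x y : 'cV[R[i]]_N) :
  hadamard x y = hadamard y x.
Proof. by apply/colP => k; rewrite !mxE mulrC. Qed.

Lemma sum_impulse (R : realType) (N : nat) (f : 'cV[R[i]]_N) :
  \sum_i f i 0 *: cmx (impulse R i) = f.
Proof.
rewrite [RHS]matrix_sum_delta; apply: eq_bigr => i _.
rewrite big_ord1; congr (_ *: _).
by rewrite /cmx /impulse (map_delta_mx (real_complex R)).
Qed.

Theorem theorem3 (R : realType) (N : nat)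
    (p : 'I_N -> 'rV[R]_3) (p_inj : injective p)
    (t : R) (t_gt0 : 0 < t)
    (r : 'I_N -> R) (r_gt0 : forall i, 0 < r i)
    (delta : R) (delta_gt0 : 0 < delta)
    (E : 'I_N -> 'M[R]_(2, 3))
    (E_tangent : forall i, estimated_tangent_plane p (r i) i (E i))
    (b : 'I_N -> R) (b_gt0 : forall i, 0 < b i)
    (b_area : forall i, area (voronoi_cell p (E i) delta i) = (b i)%:E)
    (H : 'M[R]_N) (lambda : 'I_N -> R)
    (H_eigen : forall i,
       stiff_mx p t b *m col i H = - lambda i *: (mass_mx b *m col i H))
    (H_orth : H^T *m mass_mx b *m H = 1%:M)
    (V : 'M[R[i]]_N) (omega : 'I_N -> R[i])
    (V_spectral : spectral_decomposition (cmx (harmonic_mx b H)) V omega)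
    (theta : 'I_N -> R) (theta_arg : forall i, omega i = cis (theta i))
    (alpha : R) (f g : 'cV[R]_N) :
  PMFHT b V theta alpha (convolution b V theta alpha (cmx f) (cmx g)) =
  hadamard (PMFHT b V theta alpha (cmx f)) (PMFHT b V theta alpha (cmx g)).
Proof.
have [V_unitary _ _] := V_spectral.
rewrite hadamardC -[cmx f in RHS]sum_impulse PMFHT_sum hadamard_sumr.
rewrite /convolution PMFHT_sum; apply: eq_bigr => i _.
by rewrite PMFHT_translation.
Qed.
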